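(* Let $P_4$ be the path on 4 vertices. Then $W[P_4]=4$.
   Context: Graphs are finite, simple, undirected, loopless. First-order sentences about graphs use only adjacency $\sim$ and equality $=$. $W[F]$ is the minimum number of distinct variables in a first-order sentence $\Phi$ such that for every graph $G$, $G\models\Phi$ iff $G$ contains an induced subgraph isomorphic to $F$. *)

(* Defs.v *)
From HB Require Import structures.
From mathcomp Require Import all_boot.
From mathcomp Require Import boolp.

Set Implicit Arguments.
Unset Strict Implicit.
Unset Printing Implicit Defensive.

Record sgraph := SGraph {
  vertex :> finType;
  adj : rel vertex;
  adj_sym : symmetric adj;
  adj_irr : irreflexive adj }.

Definition isomorphic (G H : sgraph) : Prop :=
  exists2 f : G -> H, bijective f & forall u v, adj (f u) (f v) = adj u v.

Section Induced.
Variables (G : sgraph) (S : {set G}).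

Definition induced_adj : rel {x : G | x \in S} :=
  fun u v => adj (val u) (val v).

Fact induced_sym : symmetric induced_adj.
Proof. by move=> u v; apply: adj_sym. Qed.

Fact induced_irr : irreflexive induced_adj.
Proof. by move=> u; apply: adj_irr. Qed.

Definition induced : sgraph := SGraph induced_sym induced_irr.
End Induced.

Definition contains_induced (G F : sgraph) : Prop :=
  exists S : {set G}, isomorphic (induced S) F.

Section PathGraph.
Variable n : nat.

Definition path_adj : rel 'I_n := fun i j => (i.+1 == j) || (j.+1 == i).

Fact path_sym : symmetric path_adj.
Proof. by move=> i j; rewrite /path_adj orbC. Qed.

Fact path_irr : irreflexive path_adj.
Proof. by move=> i; rewrite /path_adj orbb gtn_eqF. Qed.

Definition path_graph : sgraph := SGraph path_sym path_irr.
End PathGraph.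

Definition P4 : sgraph := path_graph 4.

(* Variables are named by natural numbers; a name may be bound repeatedly and
   in nested scopes, which is what makes counting variables meaningful. *)
Inductive formula : Type :=
| Eq of nat & nat
| Adj of nat & nat
| Not of formula
| And of formula & formula
| Or of formula & formula
| Ex of nat & formula
| All of nat & formula.

Fixpoint vars (p : formula) : seq nat :=
  match p with
  | Eq x y | Adj x y => [:: x; y]
  | Not q => vars q
  | And q r | Or q r => vars q ++ vars r
  | Ex x q | All x q => x :: vars q
  end.

Definition num_vars (p : formula) : nat := size (undup (vars p)).

Fixpoint free_vars (p : formula) : seq nat :=
  match p with
  | Eq x y | Adj x y => [:: x; y]
  | Not q => free_vars q
  | And q r | Or q r => free_vars q ++ free_vars r
  | Ex x q | All x q => [seq y <- free_vars q | y != x]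
  end.

Definition sentence (p : formula) : Prop := free_vars p = [::].

Section Semantics.
Variable G : sgraph.

(* Assignments are partial so that sentences can be evaluated in the graph
   with no vertices; evaluating a sentence from the empty assignment never
   looks up an undefined variable. *)
Definition assignment := nat -> option G.

Definition update (s : assignment) (x : nat) (v : G) : assignment :=
  fun y => if y == x then Some v else s y.

Definition lift_rel (r : rel G) (a b : option G) : bool :=
  if (a, b) is (Some u, Some v) then r u v else false.

Fixpoint sat (s : assignment) (p : formula) : bool :=
  match p with
  | Eq x y => lift_rel eq_op (s x) (s y)
  | Adj x y => lift_rel (@adj G) (s x) (s y)
  | Not q => ~~ sat s q
  | And q r => sat s q && sat s r
  | Or q r => sat s q || sat s r
  | Ex x q => [exists v : G, sat (update s x v) q]
  | All x q => [forall v : G, sat (update s x v) q]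
  end.

Definition models (p : formula) : bool := sat (fun=> None) p.
End Semantics.

Definition defines_containment (F : sgraph) (p : formula) : Prop :=
  sentence p /\ forall G : sgraph, models G p <-> contains_induced G F.

Definition definable_with (F : sgraph) (k : nat) : Prop :=
  exists2 p : formula, defines_containment F p & num_vars p = k.

Section Existence.

Lemma contains_inducedP (G F : sgraph) :
  contains_induced G F <->
  exists2 f : F -> G, injective f & forall u v, adj (f u) (f v) = adj u v.
Proof.
split=> [[S [g [h gK hK] gA]]|[f fI fA]].
  exists (fun u => val (h u)) => [u v /val_inj /(can_inj hK) //|u v].
  by rewrite -{2}(hK u) -{2}(hK v) gA.
exists [set f u | u : F].
have fS u : f u \in [set f u | u : F] by apply: imset_f.
pose h u : induced [set f u | u : F] := Sub (f u) (fS u).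
have hI : injective h by move=> u v /(congr1 val) /fI.
have hB : bijective h.
  apply: inj_card_bij hI _; rewrite card_sig.
  by rewrite (eq_card (B := [set f u | u : F])) ?leq_imset_card.
case: hB => g hK gK; exists g; first by exists h.
by move=> u v; rewrite -fA -{2}(gK u) -{2}(gK v).
Qed.

Definition Exs (s : seq nat) (p : formula) : formula := foldr Ex p s.

Definition Ands (s : seq formula) : formula := foldr And (All 0 (Eq 0 0)) s.

Lemma free_Exs s p : free_vars (Exs s p) = [seq y <- free_vars p | y \notin s].
Proof.
elim: s => [|x s IH] /=; first by rewrite filter_predT.
rewrite IH -filter_predI; apply: eq_filter => y /=.
by rewrite inE negb_or.
Qed.

Lemma sat_Exs (G : sgraph) (s : seq nat) p (e : assignment G) :
  sat e (Exs s p) <-> exists e' : assignment G,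
    [/\ {in s, forall x, e' x}, forall x, x \notin s -> e' x = e x & sat e' p].
Proof.
elim: s e => [|x s IH] e /=.
  split=> [H|[e' [_ H]]]; first by exists e.
  by have -> : e' = e by apply/funext => y; apply: H.
split=> [/existsP[v /IH[e' [H1 H2 H3]]]|[e' [H1 H2 H3]]].
  exists e'; split=> // y; last first.
    by rewrite inE negb_or => /andP[yx /H2 ->]; rewrite /update (negbTE yx).
  case: (boolP (y \in s)) => [/H1 //|/[dup] ys /H2 ->].
  by rewrite inE (negbTE ys) orbF /update => ->.
have := H1 x (mem_head _ _); case ex : (e' x) => [v|//] _.
apply/existsP; exists v; apply/IH; exists e'; split=> // y ys.
  by apply: H1; rewrite inE ys orbT.
rewrite /update; case: eqVneq => [-> //|yx].
by apply: H2; rewrite inE negb_or yx.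
Qed.

Lemma sat_Ands (G : sgraph) (e : assignment G) s :
  sat e (Ands s) = all (sat e) s.
Proof.
elim: s => [|p s /= -> //]; apply/forallP => v /=.
exact: eqxx.
Qed.

Variable F : sgraph.

Definition literals (u v : F) : formula :=
  let x : nat := enum_rank u in let y : nat := enum_rank v in
  And (if u == v then Eq x y else Not (Eq x y))
      (if adj u v then Adj x y else Not (Adj x y)).

Definition copy_sentence : formula :=
  Exs (iota 0 #|F|) (Ands [seq literals uv.1 uv.2 | uv <- enum {: F * F}]).

Lemma copy_sentence_defines : defines_containment F copy_sentence.
Proof.
split.
  rewrite /sentence free_Exs; apply/eqP; rewrite -[_ == _]negbK -has_filter.
  apply/hasPn => y; rewrite mem_iota add0n negbK /=.
  elim: (enum _) => [//|[u v] s IH] /=.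
  rewrite mem_cat => /orP[|/IH //].
  case: eqP => _; case: adj => /=; rewrite !inE;
    by do ![case/orP] => /eqP->.
move=> G; rewrite contains_inducedP; split=> [/sat_Exs[e [H1 _]]|[f fI fA]].
  rewrite sat_Ands all_map => /allP H.
  have def (u : F) : {v | e (enum_rank u) = Some v}.
    have := H1 (enum_rank u); rewrite mem_iota add0n /= => /(_ (ltn_ord _)).
    by case: (e _) => // v _; exists v.
  pose f u := sval (def u).
  have fE (u : F) : e (enum_rank u) = Some (f u) by apply: svalP (def u).
  have {}H (u v : F) : sat e (literals u v).
    by apply: (H (u, v)); rewrite mem_enum.
  exists f => u v; have /= /andP[] := H u v.
    by case: eqP => //= _; rewrite !fE /lift_rel => /eqP nf _ /nf.
  by move=> _; case: adj => /=; rewrite !fE //= => /negbTE.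
apply/sat_Exs.
pose e y : option G :=
  if insub y is Some i then Some (f (enum_val (i : 'I_#|F|))) else None.
have fE (u : F) : e (enum_rank u) = Some (f u) by rewrite /e valK enum_rankK.
exists e; split=> [y|y|].
- by rewrite mem_iota add0n /= /e => yn; rewrite insubT.
- by rewrite mem_iota add0n /= /e => yn; rewrite insubN.
rewrite sat_Ands all_map; apply/allP => -[u v] _ /=.
apply/andP; split.
  by case: (eqVneq u v) => [->|uv] /=; rewrite !fE /lift_rel ?(inj_eq fI) ?eqxx.
by rewrite -fA; case E : (adj (f u) (f v)) => /=; rewrite !fE /lift_rel E.
Qed.

Lemma definable_with_ex : exists k, `[< definable_with F k >].
Proof.
exists (num_vars copy_sentence); apply/asboolP.
by exists copy_sentence => //; apply: copy_sentence_defines.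
Qed.
End Existence.

Definition W (F : sgraph) : nat := ex_minn (definable_with_ex F).

(* Main.v *)
Require Import Defs.
From mathcomp Require Import all_boot zify.

Set Implicit Arguments.
Unset Strict Implicit.
Unset Printing Implicit Defensive.

(** The sentence listing the atomic diagram of [P4] uses 4 variables. For the
    lower bound, fix a quantifier depth [D]. The vertices of two graphs are the
    words of length [n = 8D + 2] over four letters. In the first graph, two
    words whose longest common prefix has length [s] are adjacent iff [s] is
    odd; as [s] is ultrametric, this is a cograph. The second graph differs only
    in that words first differing at the middle position [m = 4D] are adjacent
    iff their letters there are adjacent in [P4], so it contains [P4]. In the
    [D]-round game with 3 pebbles Duplicator keeps, with [r] rounds to go, the
    common prefix lengths of corresponding pairs either equal or both at
    distance at least [4r] from the ends [0] and [n]. *)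

(** The conjunction ends in a trivial conjunct that mentions variable [0], so [0] must already name
    a vertex of [F]. *)
Lemma num_vars_copy_sentence (F : sgraph) :
  0 < #|F| -> num_vars (copy_sentence F) = #|F|.
Proof.
move=> F0; rewrite /num_vars -[RHS](size_iota 0).
apply/perm_size/uniq_perm; rewrite ?undup_uniq ?iota_uniq // => y.
rewrite mem_undup /copy_sentence.
have -> s p : vars (Exs s p) = s ++ vars p by elim: s => //= x s ->.
rewrite mem_cat; case: (boolP (y \in iota _ _)) => //= yF; apply: contraNF yF.
rewrite mem_iota add0n /=; elim: (enum _) => [|[u v] s IH] /=.
  by rewrite !inE !orbb => /eqP->.
rewrite mem_cat => /orP[|/IH //].
by case: eqP => _; case: adj => /=; rewrite !inE;
  do ![case/orP] => /eqP->.
Qed.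

Fixpoint qdepth (p : formula) : nat :=
  match p with
  | Eq _ _ | Adj _ _ => 0
  | Not q => qdepth q
  | And q r | Or q r => maxn (qdepth q) (qdepth r)
  | Ex _ q | All _ q => (qdepth q).+1
  end.

(** * Words and the ultrametric of common prefix lengths *)

Section WordGraphs.
Variable D : nat.

Let n := (8 * D).+2.
Let m := 4 * D.

Definition word := {ffun 'I_n -> 'I_4}.

Definition letter (x : word) (i : nat) : 'I_4 :=
  if insub i is Some j then x j else ord0.

(** When no position differs [find] returns [n], so equal words get the largest value. *)
Definition lcp (x y : word) : nat :=
  find (fun i => letter x i != letter y i) (iota 0 n).

Lemma lcp_le x y : lcp x y <= n.
Proof. by rewrite /lcp -[X in _ <= X](size_iota 0 n) find_size. Qed.

Lemma letter_lcp x y i : i < lcp x y -> letter x i = letter y i.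
Proof.
move=> lt_i; have := before_find 0 lt_i.
by rewrite nth_iota ?add0n ?(leq_trans lt_i) ?lcp_le // => /negbFE/eqP.
Qed.

Lemma letter_at_lcp x y :
  lcp x y < n -> letter x (lcp x y) != letter y (lcp x y).
Proof.
move=> lt_n; have h : has (fun i => letter x i != letter y i) (iota 0 n).
  by rewrite has_find size_iota.
by have := nth_find 0 h; rewrite nth_iota.
Qed.

Lemma lcp_ge x y t :
  t <= n -> (forall i, i < t -> letter x i = letter y i) -> t <= lcp x y.
Proof.
move=> tn eq_t; rewrite leqNgt; apply/negP => lt_t.
by have := letter_at_lcp (leq_trans lt_t tn); rewrite eq_t // eqxx.
Qed.

Lemma lcp_eq x y t :
  t < n -> (forall i, i < t -> letter x i = letter y i) ->
  letter x t != letter y t -> lcp x y = t.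
Proof.
move=> tn eq_t ne_t; apply/eqP; rewrite eqn_leq (lcp_ge (ltnW tn) eq_t) andbT.
by rewrite leqNgt; apply: contra ne_t => /letter_lcp->.
Qed.

Lemma lcpC x y : lcp x y = lcp y x.
Proof. by apply: eq_find => i; rewrite eq_sym. Qed.

Lemma lcpxx x : lcp x x = n.
Proof. by apply/eqP; rewrite eqn_leq lcp_le lcp_ge. Qed.

Lemma eq_lcp x y : (x == y) = (lcp x y == n).
Proof.
apply/eqP/eqP => [->|xy]; first exact: lcpxx.
apply/ffunP => i; have := @letter_lcp x y i.
by rewrite xy /letter valK => /(_ (ltn_ord i)).
Qed.

Lemma lcp_ultra x y z : minn (lcp x y) (lcp y z) <= lcp x z.
Proof.
apply: lcp_ge => [|i]; first by rewrite geq_min lcp_le.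
by rewrite leq_min => /andP[/letter_lcp-> /letter_lcp->].
Qed.

(** The isosceles property: among the three lengths of a triangle, the smallest occurs twice. *)
Lemma lcp_lt x y z : lcp x z < lcp x y -> lcp y z = lcp x z.
Proof.
by have := (lcp_ultra x y z, lcp_ultra y x z); rewrite (lcpC y x) => -[]; lia.
Qed.

Definition set_letter (x : word) (t : nat) (c : 'I_4) : word :=
  [ffun i => if val i == t then c else x i].

Lemma letter_set x t c i :
  letter (set_letter x t c) i = if (i == t) && (t < n) then c else letter x i.
Proof.
rewrite /letter; case: insubP => [j jn ji|].
  rewrite ffunE ji; case: eqP => //= <-; by rewrite jn.
by case: eqP => //= ->; case: ltnP.
Qed.

Lemma lcp_set x t c : t < n -> c != letter x t -> lcp x (set_letter x t c) = t.
Proof.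
move=> tn cx; apply: lcp_eq => // [i it|].
  by rewrite letter_set (ltn_eqF it).
by rewrite letter_set eqxx tn eq_sym.
Qed.

Lemma fresh_letter (a b : 'I_4) : exists2 c : 'I_4, c != a & c != b.
Proof.
suff /subsetPn[c _] : ~~ ([set: 'I_4] \subset [set a; b]).
  by rewrite !inE negb_or => /andP[]; exists c.
by apply/negP => /subset_leq_card; rewrite cardsT card_ord cards2; case: eqP.
Qed.

Lemma ex_lcp x t : t <= n -> exists z, lcp x z = t.
Proof.
rewrite leq_eqVlt => /orP[/eqP->|tn]; first by exists x; rewrite lcpxx.
have [c cx _] := fresh_letter (letter x t) (letter x t).
by exists (set_letter x t c); apply: lcp_set.
Qed.

(** * The two graphs on words *)

Definition word_adj (b : bool) : rel word := fun x y =>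
  let s := lcp x y in
  if b && (s == m) then path_adj (letter x s) (letter y s) else odd s.

Fact word_adj_sym b : symmetric (word_adj b).
Proof. by move=> x y; rewrite /word_adj lcpC path_sym. Qed.

Fact word_adj_irr b : irreflexive (word_adj b).
Proof.
move=> x; rewrite /word_adj lcpxx (_ : (n == m) = false) ?andbF; last first.
  by rewrite /n /m; lia.
by rewrite /n /=; lia.
Qed.

Definition word_graph b : sgraph :=
  SGraph (@word_adj_sym b) (@word_adj_irr b).

Lemma word_adj_odd b x y : lcp x y != m -> word_adj b x y = odd (lcp x y).
Proof. by move=> /negbTE sm; rewrite /word_adj sm andbF. Qed.

(* Adjacency to [y] only depends on letters that [x] and [z] share. *)
Lemma word_adj_gt b x y z :
  lcp x y < lcp x z -> word_adj b y z = word_adj b x y.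
Proof.
move=> xyz; rewrite [RHS]word_adj_sym /word_adj.
have -> : lcp y z = lcp y x by rewrite lcpC (lcp_lt xyz) lcpC.
by rewrite -(@letter_lcp x z) // lcpC.
Qed.

Lemma word_graph_contains_P4 : contains_induced (word_graph true) P4.
Proof.
apply/contains_inducedP.
have mn : m < n by rewrite /n /m; lia.
(* Letters and vertices of [P4] are both ['I_4]: each vertex is written at position [m] of a
   constant word. *)
pose w0 : word := [ffun=> ord0]; pose f (i : P4) : word := set_letter w0 m i.
have fE i : letter (f i) m = i by rewrite letter_set eqxx mn.
exists f => [i j /(congr1 (letter^~ m))|i j]; first by rewrite !fE.
rewrite /=; have [->|ij] := eqVneq i j; first by rewrite word_adj_irr path_irr.
have sm : lcp (f i) (f j) = m.
  by apply: lcp_eq => // [k km|]; rewrite ?fE // !letter_set (ltn_eqF km).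
by rewrite /word_adj sm eqxx !fE.
Qed.

(** The smallest length among four such words would split them into classes with all cross pairs at
    that length, hence all adjacent or all nonadjacent. But [P4] and its complement are both
    connected. *)
Lemma word_graph_P4_free : ~ contains_induced (word_graph false) P4.
Proof.
move/contains_inducedP => [f _ fA].
pose o k : P4 := inord k.
have oA i j : i < 4 -> j < 4 ->
    odd (lcp (f (o i)) (f (o j))) = (i.+1 == j) || (j.+1 == i).
  move=> i4 j4; have := fA (o i) (o j).
  by rewrite /= /word_adj /= /path_adj /= !inordK.
have := (oA 0 1 isT isT, oA 1 2 isT isT, oA 2 3 isT isT).
have := (oA 0 2 isT isT, oA 1 3 isT isT, oA 0 3 isT isT).
move: (f (o 0)) (f (o 1)) (f (o 2)) (f (o 3)) => a b c d /=.
move=> [[ac bd] ad] [[ab bc] cd].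
have := (lcp_ultra a b c, lcp_ultra b a c, lcp_ultra a c b).
have := (lcp_ultra b c d, lcp_ultra c b d, lcp_ultra b d c).
have := (lcp_ultra a b d, lcp_ultra b a d, lcp_ultra a d b).
rewrite !(lcpC b a) !(lcpC c b) !(lcpC d c) !(lcpC d b).
move=> [[? ?] ?] [[? ?] ?] [[? ?] ?]; lia.
Qed.

(** * Duplicator's invariant and replies *)

Definition central (r s : nat) : bool := (4 * r <= s) && (s + 4 * r < n).

Lemma central_m r : r <= D -> central r m.
Proof. by rewrite /central /n /m; lia. Qed.

Lemma centralW r s : central r.+1 s -> central r s.
Proof. by rewrite /central; lia. Qed.

Lemma parity_step s (p : bool) : exists d, 0 < d <= 2 /\ odd (s + d) = p.
Proof.
exists (if odd s == p then 2 else 1).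
by rewrite oddD; case: p; case: (odd s).
Qed.

(** This is why a round costs a margin of 4: at most 2 to set the parity, and 2 more to skip [m]. *)
Lemma central_below r s (p : bool) : central r.+1 s ->
  exists t, [/\ t < s, central r t, t != m & odd t = p].
Proof.
have [d [d_le]] := parity_step s p; rewrite /central => dp s_mid.
have [e|e] := eqVneq (s - d) m; [exists (s - d - 2) | exists (s - d)];
  by split; rewrite ?oddB -1?dp ?oddB ?oddD; lia.
Qed.

Lemma central_above r s (p : bool) : central r.+1 s ->
  exists t, [/\ s < t, central r t, t != m & odd t = p].
Proof.
have [d [d_le]] := parity_step s p; rewrite /central => dp s_mid.
have [e|e] := eqVneq (s + d) m; [exists (s + d + 2) | exists (s + d)];
  by split; rewrite -1?dp ?oddD; lia.
Qed.

Definition close (r s s' : nat) : Prop := s = s' \/ central r s && central r s'.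

Definition similar (b b' : bool) (r : nat) (x y x' y' : word) : Prop :=
  word_adj b x y = word_adj b' x' y' /\ close r (lcp x y) (lcp x' y').

Lemma similarC b b' r x y x' y' :
  similar b b' r x y x' y' -> similar b b' r y x y' x'.
Proof.
by rewrite /similar (lcpC y) (lcpC y') (word_adj_sym b y) (word_adj_sym b' y').
Qed.

Lemma similar_flip b b' r x y x' y' :
  similar b b' r x y x' y' -> similar b' b r x' y' x y.
Proof. by case=> a [e|/andP[h h']]; split=> //; [left | right; rewrite h h']. Qed.

Lemma similarW b b' r x y x' y' :
  similar b b' r.+1 x y x' y' -> similar b b' r x y x' y'.
Proof.
by case=> a [?|/andP[/centralW h /centralW h']]; split=> //;
  [left | right; rewrite h h'].
Qed.

Lemma similarxx b b' r x x' : similar b b' r x x x' x'.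
Proof. by split; [rewrite !word_adj_irr | left; rewrite !lcpxx]. Qed.

(** The length [n] is never central, even for [r = 0]. *)
Lemma similar_eq b b' r x y x' y' :
  similar b b' r x y x' y' -> (x == y) = (x' == y').
Proof.
rewrite !eq_lcp; case=> _ [->//|/andP[]].
by rewrite /central; case: eqP; case: eqP; lia.
Qed.

(** Here [z'] branches off at [t], before [x'] and [y'] part, and so relates to both alike. *)
Lemma reply_below b b' r x y x' y' z t :
  t < lcp x' y' -> t != m ->
  word_adj b x z = odd t -> word_adj b y z = odd t ->
  close r (lcp x z) t -> close r (lcp y z) t ->
  exists z', similar b b' r x z x' z' /\ similar b b' r y z y' z'.
Proof.
move=> lt_t tm xzp yzp xzt yzt.
have [z' xz'] : exists z', lcp x' z' = t.
  by apply: ex_lcp; apply: leq_trans (ltnW lt_t) (lcp_le _ _).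
have yz' : lcp y' z' = t by rewrite (@lcp_lt x') xz'.
exists z'; split; split; rewrite ?xz' ?yz' //.
  by rewrite xzp word_adj_odd xz'.
by rewrite yzp word_adj_odd yz'.
Qed.

(** Here [z'] follows [x'] beyond the point where [y'] leaves, and so relates to [y'] as [x']
    does. *)
Lemma reply_above b b' r x y x' y' z t :
  lcp x' y' < t -> t <= n -> t != m ->
  word_adj b x z = odd t -> word_adj b y z = word_adj b' x' y' ->
  close r (lcp x z) t -> close r (lcp y z) (lcp x' y') ->
  exists z', similar b b' r x z x' z' /\ similar b b' r y z y' z'.
Proof.
move=> gt_t tn tm xzp yzp xzt yzt.
have [z' xz'] := ex_lcp x' tn.
have yz' : lcp y' z' = lcp x' y' by rewrite lcpC (@lcp_lt x') ?xz'.
exists z'; split; split; rewrite ?xz' ?yz' //.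
  by rewrite xzp word_adj_odd xz'.
by rewrite yzp (@word_adj_gt _ x' y' z') ?xz'.
Qed.

(** One round of the game: with three pebbles, a reply has to respect only two others. *)
Lemma forth b b' r x y x' y' z :
  r < D -> similar b b' r.+1 x y x' y' ->
  exists z', similar b b' r x z x' z' /\ similar b b' r y z y' z'.
Proof.
wlog yz_xz : x y x' y' / lcp y z <= lcp x z => [IH|] rD xy.
  have [le|/ltnW le] := leqP (lcp y z) (lcp x z); first exact: IH le rD xy.
  by have [z' []] := IH _ _ _ _ le rD (similarC xy); exists z'.
have := (lcp_ultra x y z, lcp_ultra y x z, lcp_ultra x z y).
rewrite (lcpC y x) (lcpC z y) => -[[u1 u2] u3].
have m_mid := central_m rD.
have le_n := lcp_le x z.
case: xy => Axy s_close.
have Ayz : lcp x y < lcp x z -> word_adj b y z = word_adj b' x' y'.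
  by rewrite -Axy; apply: word_adj_gt.
have [/andP[s_mid s'_mid]|s_ends] :=
  boolP (central r.+1 (lcp x y) && central r.+1 (lcp x' y')).
  (* A length near either end is copied exactly; it cannot be [m], so its parity decides
     adjacency. *)
  have [low|ge_low] := ltnP (lcp x z) (4 * r).
    have eq_yz : lcp y z = lcp x z.
      by apply: lcp_lt; move: s_mid; rewrite /central; lia.
    have tm : lcp x z != m by move: m_mid; rewrite /central; lia.
    apply: (@reply_below _ _ _ _ _ _ _ _ (lcp x z)) => //; try by left.
    - by move: s'_mid; rewrite /central; lia.
    - exact: word_adj_odd.
    - by rewrite word_adj_odd eq_yz.
  have [high|lt_high] := leqP n (lcp x z + 4 * r).
    have tm : lcp x z != m by move: m_mid; rewrite /central; lia.
    have lt_s : lcp x y < lcp x z by move: s_mid; rewrite /central; lia.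
    apply: (@reply_above _ _ _ _ _ _ _ _ (lcp x z)) => //; try by left.
    - by move: s'_mid; rewrite /central; lia.
    - exact: word_adj_odd.
    - exact: Ayz.
    - have -> : lcp y z = lcp x y by lia.
      by right; rewrite (centralW s_mid) centralW.
  (* All lengths are now central, and only the two adjacencies to [z] remain to be matched. *)
  have xz_mid : central r (lcp x z) by rewrite /central ge_low.
  have yz_mid : central r (lcp y z).
    by move: s_mid; rewrite /central; lia.
  have [pq|pq] := eqVneq (word_adj b x z) (word_adj b y z).
    have [t [lt_t t_mid tm tp]] := central_below (word_adj b x z) s'_mid.
    by apply: (reply_below b' lt_t tm) => //; rewrite -?pq ?tp //; right;
      rewrite ?xz_mid ?yz_mid.
  have t_le t : central r t -> t <= n by rewrite /central; lia.
  (* The two adjacencies differ, so one of them equals that of [x'] and [y']. It is inherited by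
     placing [z'] closer to the other word, even if [z] was not. *)
  have [ys|ys] := eqVneq (word_adj b y z) (word_adj b' x' y').
    have [t [gt_t t_mid tm tp]] := central_above (word_adj b x z) s'_mid.
    by apply: (reply_above gt_t (t_le _ t_mid) tm) => //; right;
      rewrite ?xz_mid ?yz_mid ?t_mid ?(centralW s'_mid).
  have xs : word_adj b x z = word_adj b' y' x'.
    by move: pq ys; rewrite (word_adj_sym _ y'); do 3 case: word_adj.
  have [t [gt_t t_mid tm tp]] := central_above (word_adj b y z) s'_mid.
  rewrite lcpC in gt_t s'_mid.
  have [||z' [? ?]] := reply_above gt_t (t_le _ t_mid) tm (esym tp) xs (r := r).
  - by right; rewrite yz_mid.
  - by right; rewrite xz_mid (centralW s'_mid).
  - by exists z'.
have {s_close}s_eq : lcp x y = lcp x' y' by case: s_close s_ends => [|->].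
have sm : lcp x y != m.
  by apply: contraNneq s_ends => e; rewrite -s_eq e m_mid.
have [lt_s|gt_s|eq_s] := ltngtP (lcp x z) (lcp x y).
- have eq_yz : lcp y z = lcp x z by apply: lcp_lt.
  have Ayx : word_adj b y z = word_adj b x z.
    by rewrite word_adj_sym; apply: word_adj_gt.
  (* At length [m] the graphs may disagree, so [z'] uses a nearby central length whose parity gives
     the required adjacency. *)
  have [tm|tm] := eqVneq (lcp x z) m.
    have [t [lt_t t_mid t_m tp]] := central_below (word_adj b x z) m_mid.
    apply: (@reply_below _ _ _ _ _ _ _ _ t) => //; rewrite ?Ayx //; try lia.
      by right; rewrite tm t_mid (centralW m_mid).
    by right; rewrite eq_yz tm t_mid (centralW m_mid).
  apply: (@reply_below _ _ _ _ _ _ _ _ (lcp x z));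
    rewrite ?Ayx ?eq_yz -?s_eq //; try (exact: word_adj_odd); by left.
- have eq_yz : lcp y z = lcp x y by lia.
  have [tm|tm] := eqVneq (lcp x z) m.
    have [t [gt_t t_mid t_m tp]] := central_above (word_adj b x z) m_mid.
    apply: (@reply_above _ _ _ _ _ _ _ _ t) => //; rewrite ?Ayz ?eq_yz //;
      rewrite -?s_eq; try lia; try by left.
    - by move: t_mid; rewrite /central; lia.
    - by right; rewrite tm t_mid (centralW m_mid).
  apply: (@reply_above _ _ _ _ _ _ _ _ (lcp x z));
    rewrite ?Ayz ?eq_yz -?s_eq //; try (exact: word_adj_odd); by left.
have eq_yz : lcp y z = lcp x y by lia.
have [sn|sn] := eqVneq (lcp x y) n.
  have /eqP<- : x == z by rewrite eq_lcp eq_s sn.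
  have /eqP<- : x == y by rewrite eq_lcp sn.
  have /eqP<- : x' == y' by rewrite eq_lcp -s_eq sn.
  by exists x'; split; apply: similarxx.
have s_n : lcp x' y' < n by rewrite -s_eq; lia.
(* A third letter where [x'] and [y'] part makes all three lengths equal; the common value is not
   [m], so parity decides. *)
have [c cx cy] := fresh_letter (letter x' (lcp x' y')) (letter y' (lcp x' y')).
have xz' := lcp_set s_n cx; exists (set_letter x' (lcp x' y') c).
have yz' : lcp y' (set_letter x' (lcp x' y') c) = lcp x' y'.
  apply: lcp_eq => // [i lt_i|].
    by rewrite -(letter_lcp lt_i) letter_set ltn_eqF.
  by rewrite letter_set eqxx s_n eq_sym.
rewrite /similar xz' yz' eq_yz eq_s s_eq.
rewrite !word_adj_odd ?xz' ?yz' ?eq_yz ?eq_s -?s_eq //.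
by split; split=> //; left.
Qed.

(** * From the game to formulas, with variables as pebbles *)

Definition equivalent (b b' : bool) (r : nat) (V : seq nat)
    (e : assignment (word_graph b)) (e' : assignment (word_graph b')) : Prop :=
  {in V, forall u, isSome (e u) = isSome (e' u)} /\
  {in V &, forall u v x y x' y', e u = Some x -> e v = Some y ->
     e' u = Some x' -> e' v = Some y' -> similar b b' r x y x' y'}.

Lemma equivalent_flip b b' r V e e' :
  @equivalent b b' r V e e' -> @equivalent b' b r V e' e.
Proof.
case=> dom sim; split=> [u /dom->//|u v uV vV x y x' y' *].
by apply: similar_flip; apply: sim uV vV _ _ _ _ _ _ _ _.
Qed.

Lemma equivalent_update b b' r V e e' w (z : word_graph b) :
  r < D -> size V <= 3 -> w \in V -> @equivalent b b' r.+1 V e e' ->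
  exists z' : word_graph b',
    @equivalent b b' r V (update e w z) (update e' w z').
Proof.
move=> rD V3 wV [dom sim].
(* The pebble [w] is being moved, so at most two placed pebbles constrain the reply. *)
pose L := [seq u <- V | (u != w) && e u].
have L2 : size L <= 2.
  rewrite -ltnS (leq_trans _ V3) // size_filter ltn_neqAle count_size andbT.
  rewrite -all_count; apply/allPn; exists w => //=.
  by rewrite eqxx.
have LV u : u \in L -> u \in V by rewrite mem_filter => /andP[].
have Lval u : u \in L -> exists x x', e u = Some x /\ e' u = Some x'.
  move=> uL; have := dom u (LV u uL); move: uL; rewrite mem_filter.
  case: (e u) => [x|]; last by rewrite andbF.
  by case: (e' u) => // x' _ _; exists x, x'.
have [z' z'L] : exists z' : word, {in L, forall u x x',
    e u = Some x -> e' u = Some x' -> similar b b' r x z x' z'}.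
  move: L L2 LV Lval => [|u [|v []]] //= _ LV Lval; first by exists z.
    have [x [x' [ex ex']]] := Lval u (mem_head _ _).
    have uV := LV u (mem_head _ _).
    (* A single remaining pebble counts as two coinciding ones. *)
    have [z' [h _]] := forth z rD (sim u u uV uV x x x' x' ex ex ex' ex').
    by exists z' => _ /[!inE]/eqP-> y y'; rewrite ex ex' => -[<-] [<-].
  have uL : u \in [:: u; v] by rewrite !inE eqxx.
  have vL : v \in [:: u; v] by rewrite !inE eqxx orbT.
  have [x [x' [ex ex']]] := Lval u uL.
  have [y [y' [ey ey']]] := Lval v vL.
  have xy := sim u v (LV u uL) (LV v vL) x y x' y' ex ey ex' ey'.
  have [z' [hx hy]] := forth z rD xy.
  exists z' => t /[!inE]/orP[]/eqP-> s s'; first by rewrite ex ex' => -[<-] [<-].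
  by rewrite ey ey' => -[<-] [<-].
have inL u x : u \in V -> u != w -> e u = Some x -> u \in L.
  by rewrite mem_filter => -> -> ->.
exists z'; split=> [u uV|u v uV vV x y x' y'].
  by rewrite /update; case: eqP => // _; apply: dom.
rewrite /update; case: eqVneq => [_|uw]; case: eqVneq => [_|vw].
- by move=> [<-] [<-] [<-] [<-]; apply: similarxx.
- by move=> [<-] ey [<-] ey'; exact: similarC (z'L v (inL v y vV vw ey) y y' ey ey').
- by move=> ex [<-] ex' [<-]; exact: z'L u (inL u x uV uw ex) x x' ex ex'.
by move=> *; apply: similarW; apply: (sim u v).
Qed.

(** Atoms see one pair of pebbles, and each quantifier is one round. The induction varies both
    graphs because the converse of a quantifier step swaps them. *)
Lemma sat_equivalent b b' p r V e e' :
  size V <= 3 -> {subset vars p <= V} -> qdepth p <= r <= D ->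
  @equivalent b b' r V e e' -> sat e p = sat e' p.
Proof.
move=> V3; elim: p b b' r e e' =>
  [u v|u v|p IHp|p IHp q IHq|p IHp q IHq|w p IHp|w p IHp] b b' r e e' /= pV rD ee'.
- have uV := pV u (mem_head _ _).
  have vV : v \in V by apply: pV; rewrite !inE eqxx orbT.
  case: ee' => dom sim; move: (dom u uV) (dom v vV) (sim u v uV vV).
  case: (e u) (e' u) (e v) (e' v) => [x|] [x'|] [y|] [y'|] //= _ _ xy.
  exact: similar_eq (xy x y x' y' _ _ _ _).
- have uV := pV u (mem_head _ _).
  have vV : v \in V by apply: pV; rewrite !inE eqxx orbT.
  case: ee' => dom sim; move: (dom u uV) (dom v vV) (sim u v uV vV).
  case: (e u) (e' u) (e v) (e' v) => [x|] [x'|] [y|] [y'|] //= _ _ xy.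
  by case: (xy x y x' y').
- by rewrite (IHp b b' r e e').
- rewrite (IHp b b' r e e') ?(IHq b b' r e e') //; try lia;
    by move=> u up; apply: pV; rewrite mem_cat up ?orbT.
- rewrite (IHp b b' r e e') ?(IHq b b' r e e') //; try lia;
    by move=> u up; apply: pV; rewrite mem_cat up ?orbT.
- have wV := pV w (mem_head _ _).
  have {}pV : {subset vars p <= V}.
    by move=> u up; apply: pV; rewrite inE up orbT.
  case: r rD ee' => [|r] // rD ee'.
  have half c c' (f : assignment (word_graph c))
      (f' : assignment (word_graph c')) :
      equivalent r.+1 V f f' ->
      [exists v, sat (update f w v) p] -> [exists v, sat (update f' w v) p].
    move=> ff' /existsP[z fz].
    have [|z' zz'] := equivalent_update z _ V3 wV ff'; first by case/andP: rD.
    by apply/existsP; exists z'; rewrite -(IHp _ _ r _ _ pV _ zz') //; lia.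
  by apply/idP/idP; apply: half => //; apply: equivalent_flip.
- have wV := pV w (mem_head _ _).
  have {}pV : {subset vars p <= V}.
    by move=> u up; apply: pV; rewrite inE up orbT.
  case: r rD ee' => [|r] // rD ee'.
  have half c c' (f : assignment (word_graph c))
      (f' : assignment (word_graph c')) :
      equivalent r.+1 V f f' ->
      [forall v, sat (update f' w v) p] -> [forall v, sat (update f w v) p].
    move=> ff' /forallP f'p; apply/forallP => z.
    have [|z' zz'] := equivalent_update z _ V3 wV ff'; first by case/andP: rD.
    by rewrite (IHp _ _ r _ _ pV _ zz') //; lia.
  by apply/idP/idP; apply: half => //; apply: equivalent_flip.
Qed.

End WordGraphs.

(** Taking [D] to be the quantifier depth of a sentence with at most 3 variables, the two graphs
    agree on it from the empty assignment, yet only one contains [P4]. *)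
Lemma definable_with_P4_gt3 k : definable_with P4 k -> 3 < k.
Proof.
case=> p [_ def_p] <-; rewrite ltnNge; apply/negP => p3.
apply: (@word_graph_P4_free (qdepth p)); apply/def_p.
have /def_p := word_graph_contains_P4 (qdepth p).
rewrite /models.
rewrite (@sat_equivalent _ _ false _ (qdepth p) (undup (vars p)) _ (fun=> None)) //.
- by move=> u; rewrite mem_undup.
- by rewrite !leqnn.
Qed.

Theorem theorem4p6 : W P4 = 4.
Proof.
rewrite /W; case: ex_minnP => k /boolp.asboolP /definable_with_P4_gt3 k4 k_min.
apply/eqP; rewrite eqn_leq k4 andbT; apply/k_min/boolp.asboolP.
exists (copy_sentence P4); first exact: copy_sentence_defines.
by rewrite num_vars_copy_sentence card_ord.
Qed.
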